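(* Suppose that the full system $\dot z=f(z,u)$ with $z=(z_1,z_2,z_c)$ decomposes into self-contained subsystems, i.e. it has the form $\dot z_1=f_1(z_1,z_c,u)$, $\dot z_2=f_2(z_2,z_c,u)$, $\dot z_c=f_c(z_c,u)$. Let $t<0$. If the target sets satisfy $\mathcal T=\mathrm{proj}_1^{-1}(\mathcal T_1)\cup \mathrm{proj}_2^{-1}(\mathcal T_2)$, then the maximal backward reachable sets satisfy $$\mathcal R(t)=\mathrm{proj}_1^{-1}(\mathcal R_1(t))\cup \mathrm{proj}_2^{-1}(\mathcal R_2(t)).$$
   Context: System: $z\in\mathbb R^n$ evolves by $\dot z(s)=f(z(s),u(s))$, $s\in[t,0]$, $t<0$, with $u(s)\in\mathcal U$, $\mathcal U\subset\mathbb R^{n_u}$ compact; $f:\mathbb R^n\times\mathcal U\to\mathbb R^n$ is uniformly continuous, bounded, and Lipschitz in $z$ for fixed $u$. Control functions $u(\cdot)$ range over the set $\mathbb U$ of measurable functions $[t,0]\to\mathcal U$. For each $z$ and $u(\cdot)$ let $\zeta(s;z,t,u(\cdot))$, $s\in[t,0]$, be the unique trajectory (satisfying the ODE for almost every $s$) with $\zeta(t;z,t,u(\cdot))=z$. State partition: $z=(z_1,z_2,z_c)$ with $z_i\in\mathbb R^{n_i}$, $z_c\in\mathbb R^{n_c}$, $n_1,n_2>0$, $n_c\ge 0$, $n_1+n_2+n_c=n$. Subsystem states are $x_i=(z_i,z_c)\in\mathbb R^{n_i+n_c}$, $i=1,2$. Subsystem $i$ has dynamics $\dot z_i=f_i(z_i,z_c,u)$,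 $\dot z_c=f_c(z_c,u)$, and its trajectory starting at $x_i$ at time $t$ under $u(\cdot)$ is denoted $\xi_i(s;x_i,t,u(\cdot))$. Back-projection: for $S_i\subseteq\mathbb R^{n_i+n_c}$, $\mathrm{proj}_i^{-1}(S_i)=\{z=(z_1,z_2,z_c)\in\mathbb R^n:(z_i,z_c)\in S_i\}$. Target sets: $\mathcal T\subseteq\mathbb R^n$ (full system), $\mathcal T_i\subseteq\mathbb R^{n_i+n_c}$ (subsystem $i$). Maximal backward reachable sets: $\mathcal R(t)=\{z:\exists u(\cdot)\in\mathbb U,\ \zeta(0;z,t,u(\cdot))\in\mathcal T\}$ and $\mathcal R_i(t)=\{x_i:\exists u(\cdot)\in\mathbb U,\ \xi_i(0;x_i,t,u(\cdot))\in\mathcal T_i\}$. *)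

(* Defs.v *)
From mathcomp Require Import all_boot all_order all_algebra.
From mathcomp Require Import all_classical all_reals all_analysis.
From mathcomp Require Import measurable_realfun.
Import Order.TTheory GRing.Theory Num.Theory.
Import numFieldNormedType.Exports.

Set Implicit Arguments.
Unset Strict Implicit.
Unset Printing Implicit Defensive.

Local Open Scope classical_set_scope.
Local Open Scope ring_scope.

(* R^n is 'rV[R]_n with the library's sup norm.  Functions whose mathematical
   domain is [t, 0] or R^n x U are total here; only their values on that domain
   matter in what follows. *)

Definition unif_continuous_on (R : realType) (V W : normedModType R)
    (A : set V) (g : V -> W) : Prop :=
  forall e : R, 0 < e -> exists2 d : R, 0 < d &
    forall p q : V, A p -> A q -> `|p - q| < d -> `|g p - g q| < e.

Definition absolutely_continuous (R : realType) (V : normedModType R)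
    (a b : R) (g : R -> V) : Prop :=
  forall e : R, 0 < e -> exists2 d : R, 0 < d &
    forall (m : nat) (x y : 'I_m -> R),
      (forall i, [/\ a <= x i, x i <= y i & y i <= b]) ->
      trivIset setT (fun i => `]x i, y i[%classic) ->
      \sum_(i < m) (y i - x i) < d ->
      \sum_(i < m) `|g (y i) - g (x i)| < e.

(* [lebesgue_measure] lives on the Borel sigma-algebra; Lebesgue measurable
   sets are the members of its completion. *)
Definition lebesgue_measurable (R : realType) (A : set R) : Prop :=
  (completed_algebra_gen (@lebesgue_measure R)).-sigma.-measurable A.

Definition admissible_control (R : realType) (nu : nat) (U : set 'rV[R]_nu)
    (t : R) (u : R -> 'rV[R]_nu) : Prop :=
  (forall s, s \in `[t, 0] -> U (u s)) /\
  (forall O, open O -> lebesgue_measurable (`[t, 0]%classic `&` u @^-1` O)).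

(* Solutions in the sense of Caratheodory.  The derivative is two-sided; the
   endpoints of [t, 0] form a null set, so the values of [zeta] outside [t, 0]
   are irrelevant. *)
Record trajectory (R : realType) (n nu : nat)
    (f : 'rV[R]_n -> 'rV[R]_nu -> 'rV[R]_n) (z : 'rV[R]_n) (t : R)
    (u : R -> 'rV[R]_nu) (zeta : R -> 'rV[R]_n) : Prop := Trajectory {
  trajectory_init : zeta t = z ;
  trajectory_ac : absolutely_continuous t 0 zeta ;
  trajectory_ode : {ae @lebesgue_measure R, forall s,
    s \in `[t, 0] -> is_derive s 1 zeta (f (zeta s) (u s))} }.

(* Where the trajectory [zeta] from z under u is unique, the inner condition
   says that its endpoint lies in T. *)
Definition max_brs (R : realType) (n nu : nat) (U : set 'rV[R]_nu)
    (f : 'rV[R]_n -> 'rV[R]_nu -> 'rV[R]_n) (T : set 'rV[R]_n) (t : R) :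
    set 'rV[R]_n :=
  [set z | exists u, admissible_control U t u /\
     exists zeta, trajectory f z t u zeta /\ T (zeta 0)].

(* z = (z_1, z_2, z_c) is row_mx (row_mx z_1 z_2) z_c. *)
Section StatePartition.
Context (R : realType) (n1 n2 nc : nat).
Implicit Type z : 'rV[R]_(n1 + n2 + nc).

Definition part1 z : 'rV[R]_n1 := lsubmx (lsubmx z).
Definition part2 z : 'rV[R]_n2 := rsubmx (lsubmx z).
Definition partc z : 'rV[R]_nc := rsubmx z.

Definition back_proj1 (S : set 'rV[R]_(n1 + nc)) : set 'rV[R]_(n1 + n2 + nc) :=
  [set z | S (row_mx (part1 z) (partc z))].
Definition back_proj2 (S : set 'rV[R]_(n2 + nc)) : set 'rV[R]_(n1 + n2 + nc) :=
  [set z | S (row_mx (part2 z) (partc z))].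

End StatePartition.

Definition subsystem (R : realType) (ni nc nu : nat)
    (fi : 'rV[R]_ni -> 'rV[R]_nc -> 'rV[R]_nu -> 'rV[R]_ni)
    (fc : 'rV[R]_nc -> 'rV[R]_nu -> 'rV[R]_nc)
    (x : 'rV[R]_(ni + nc)) (u : 'rV[R]_nu) : 'rV[R]_(ni + nc) :=
  row_mx (fi (lsubmx x) (rsubmx x) u) (fc (rsubmx x) u).

(* Main.v *)
Require Import Defs.
From mathcomp Require Import all_boot all_order all_algebra.
From mathcomp Require Import all_classical all_reals all_analysis.
From mathcomp Require Import lra measurable_realfun.
Import Order.TTheory GRing.Theory Num.Theory.
Import numFieldNormedType.Exports.
Set Implicit Arguments.
Unset Strict Implicit.
Unset Printing Implicit Defensive.
Local Open Scope classical_set_scope.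
Local Open Scope ring_scope.

(** Cutting a trajectory of the full system into blocks of coordinates gives
trajectories of both subsystems, because each subsystem is self-contained; this
is the inclusion from left to right.

For the converse let a trajectory of subsystem 1 reach [T1] under the control
[u]. Together with [u] it prescribes [z_c], and all that is missing for a
trajectory of the full system is a solution [z_2] of
  z_2' = f2 (z_2, z_c(s), u(s)),   z_2(t) given,
a differential equation whose right-hand side is only measurable in time.
Which solution is taken does not matter, since membership in [proj_1^-1 T1] does
not depend on [z_2]: its existence suffices. Subsystem 2 is symmetric.

Existence is Caratheodory's theorem ([caratheodory_existence]), proved by
Tonelli's method. Delaying the state in the integral equation by [h] > 0 gives
equations that are solved by finitely many iterations ([delayed_solution]).
Their solutions share a Lipschitz constant, a bound of the velocity, so by
Tychonoff's theorem they cluster uniformly at some curve as [h] tends to 0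
([lipschitz_curves_cluster]). The velocity is continuous in the state with a
modulus that is uniform in time, hence the integral equation passes to the
cluster point with a plain estimate, and the differential equation follows
almost everywhere from Lebesgue's differentiation theorem.

The integrals are taken on the Borel sigma-algebra, whereas the control is only
Lebesgue measurable. It is therefore first replaced by a Borel control that is
equal to it almost everywhere and still takes its values in [U]
([admissible_control_borel]); the velocity is then Borel measurable along every
continuous curve ([ball_measurable_comp]). *)

(** * Blocks of coordinates *)

Section row_norm.
Context (R : realType).

Lemma row_norm_le n (v : 'rV[R]_n) (M : R) :
  0 <= M -> (`|v| <= M) = [forall j, `|v 0 j| <= M].
Proof.
move=> M0; rewrite [`|v|]mx_normrE.
apply/idP/forallP => [/bigmax_leP[_ h] j|h]; first exact: (h (0, j)).
by apply/bigmax_leP; split => // -[i j] _ /=; rewrite ord1.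
Qed.

Lemma row_norm_lt n (v : 'rV[R]_n) (M : R) :
  0 < M -> (`|v| < M) = [forall j, `|v 0 j| < M].
Proof.
move=> M0; rewrite [`|v|]mx_normrE.
apply/idP/forallP => [/bigmax_ltP[_ h] j|h]; first exact: (h (0, j)).
by apply/bigmax_ltP; split => // -[i j] _ /=; rewrite ord1.
Qed.

Lemma row_coord_le n (v : 'rV[R]_n) j : `|v 0 j| <= `|v|.
Proof. by have := row_norm_le v (normr_ge0 v); rewrite lexx => /esym/forallP. Qed.

Lemma norm_row_mx m n (v : 'rV[R]_m) (w : 'rV[R]_n) :
  `|row_mx v w| = Num.max `|v| `|w|.
Proof.
have M0 : 0 <= Num.max `|v| `|w| by rewrite le_max normr_ge0.
apply/eqP; rewrite eq_le row_norm_le// ge_max !row_norm_le//.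
apply/andP; split; last (apply/andP; split); apply/forallP => j.
- case: (split_ordP j) => k ->; rewrite ?row_mxEl ?row_mxEr le_max.
    by rewrite row_coord_le.
  by rewrite row_coord_le orbT.
- by rewrite -(row_mxEl v w) row_coord_le.
- by rewrite -(row_mxEr v w) row_coord_le.
Qed.

End row_norm.

Section row_derivative.
Context (R : realType).

Lemma is_derive_rowP n (y : R -> 'rV[R]_n) (s : R) (v : 'rV[R]_n) :
  is_derive s 1 y v <-> forall j, is_derive s 1 (fun x => y x 0 j) (v 0 j).
Proof.
split=> [[dy yE] j|h].
  split; first by have /derivable_mxP := dy; exact.
  by rewrite -yE derive_mx// mxE.
have dy : derivable y s 1.
  by apply/derivable_mxP => i j; rewrite ord1; case: (h j).
split => //; apply/rowP => j; rewrite derive_mx// mxE.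
by case: (h j).
Qed.

Lemma is_derive_row_mx m n (y : R -> 'rV[R]_m) (z : R -> 'rV[R]_n) (s : R) v w :
  is_derive s 1 (fun x => row_mx (y x) (z x)) (row_mx v w) <->
  is_derive s 1 y v /\ is_derive s 1 z w.
Proof.
split=> [/is_derive_rowP h|[/is_derive_rowP hy /is_derive_rowP hz]].
  split; apply/is_derive_rowP => j.
  - have := h (lshift n j); rewrite row_mxEl.
    by under eq_fun do rewrite row_mxEl.
  - have := h (rshift m j); rewrite row_mxEr.
    by under eq_fun do rewrite row_mxEr.
apply/is_derive_rowP => j; case: (split_ordP j) => k ->.
- by under eq_fun do rewrite row_mxEl; rewrite row_mxEl.
- by under eq_fun do rewrite row_mxEr; rewrite row_mxEr.
Qed.

End row_derivative.

Section absolute_continuity.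
Context (R : realType) (a b : R).

Lemma absolutely_continuous_dominated (V W : normedModType R)
    (g : R -> V) (h : R -> W) :
  (forall x y, `|h y - h x| <= `|g y - g x|) ->
  absolutely_continuous a b g -> absolutely_continuous a b h.
Proof.
move=> hg acg e e0; have [d d0 gd] := acg _ e0; exists d => // m x y xy tr sd.
by apply: le_lt_trans (gd m x y xy tr sd); apply: ler_sum => i _.
Qed.

Lemma absolutely_continuous_row_mx m n (y : R -> 'rV[R]_m) (z : R -> 'rV[R]_n) :
  absolutely_continuous a b (fun s => row_mx (y s) (z s)) <->
  absolutely_continuous a b y /\ absolutely_continuous a b z.
Proof.
split=> [ac|[acy acz] e e0].
  split; apply: absolutely_continuous_dominated ac => s s'.
  - by rewrite opp_row_mx add_row_mx norm_row_mx le_max lexx.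
  - by rewrite opp_row_mx add_row_mx norm_row_mx le_max lexx orbT.
have e20 : 0 < e / 2 by rewrite divr_gt0.
have [d d0 yd] := acy _ e20; have [d' d'0 zd] := acz _ e20.
exists (Num.min d d'); first by rewrite lt_min d0.
move=> k p q pq tr; rewrite lt_min => /andP[sd sd'].
apply: (@le_lt_trans _ _ (\sum_(i < k) (`|y (q i) - y (p i)| +
                                        `|z (q i) - z (p i)|))).
  apply: ler_sum => i _; rewrite opp_row_mx add_row_mx norm_row_mx ge_max.
  by rewrite lerDl lerDr !normr_ge0.
by rewrite big_split/= [e]splitr ltrD// ?yd ?zd.
Qed.

Lemma lipschitz_absolutely_continuous (V : normedModType R) (M : R)
    (y : R -> V) :
  (forall s s', `|y s - y s'| <= M * `|s - s'|) -> absolutely_continuous a b y.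
Proof.
move=> yM e e0; exists (e / (`|M| + 1)).
  by rewrite divr_gt0// ltr_wpDl.
move=> m p q pq _; rewrite ltr_pdivlMr ?ltr_wpDl// => sd.
apply: le_lt_trans sd; rewrite mulr_suml; apply: ler_sum => i _.
apply: le_trans (yM _ _) _; have [_ pqi _] := pq i.
rewrite ger0_norm ?subr_ge0// mulrC ler_wpM2l ?subr_ge0//.
by rewrite (le_trans (ler_norm _))// lerDl.
Qed.

Lemma absolutely_continuous_dist (V : normedModType R) (y : R -> V) :
  absolutely_continuous a b y -> forall e, 0 < e -> exists2 d, 0 < d &
    forall s s', s \in `[a, b] -> s' \in `[a, b] -> `|s - s'| < d ->
      `|y s - y s'| < e.
Proof.
move=> acy e e0; have [d d0 yd] := acy _ e0; exists d => //.
suff main s s' : s \in `[a, b] -> s' \in `[a, b] -> s <= s' -> `|s - s'| < d ->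
    `|y s - y s'| < e.
  move=> s s' sab s'ab ss'; have [le|/ltW le] := leP s s'; first exact: main.
  by rewrite distrC; apply: main => //; rewrite distrC.
rewrite !in_itv/= => /andP[as_ _] /andP[_ sb'] ss' dss'.
have := yd 1%N (fun=> s) (fun=> s'); rewrite !big_ord1 distrC; apply => //.
- by move=> i j _ _ _; rewrite !ord1.
- by rewrite distrC ger0_norm ?subr_ge0// in dss'.
Qed.

End absolute_continuity.

Section caratheodory_solution.
Context (R : realType) (a b : R).

(** The velocity is an explicit function of time, so that solutions can be cut
into blocks of coordinates and put together again without regard to how the
velocity depends on the state. *)
Definition ac_primitive (V : normedModType R) (v y : R -> V) : Prop :=
  absolutely_continuous a b y /\
  {ae @lebesgue_measure R, forall s, s \in `[a, b] -> is_derive s 1 y (v s)}.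

Lemma ac_primitive_row_mx m n (v y : R -> 'rV[R]_m) (w z : R -> 'rV[R]_n) :
  ac_primitive (fun s => row_mx (v s) (w s)) (fun s => row_mx (y s) (z s)) <->
  ac_primitive v y /\ ac_primitive w z.
Proof.
have aeF := ae_filter_ringOfSetsType (@lebesgue_measure R).
rewrite /ac_primitive absolutely_continuous_row_mx; split.
  move=> [[acy acz] dyz]; split; split => //; apply: filterS dyz => s ds sab;
    by have /is_derive_row_mx[] := ds sab.
move=> [[acy dy] [acz dz]]; split => //.
apply: filterS2 dy dz => s ds ds' sab; apply/is_derive_row_mx.
by split; [exact: ds|exact: ds'].
Qed.

Lemma eq_ac_primitive (V : normedModType R) (v w y : R -> V) :
  {ae @lebesgue_measure R, forall s, s \in `[a, b] -> v s = w s} ->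
  ac_primitive v y -> ac_primitive w y.
Proof.
have aeF := ae_filter_ringOfSetsType (@lebesgue_measure R).
move=> vw [acy dy]; split => //; apply: filterS2 vw dy => s vws ds sab.
by rewrite -vws//; exact: ds.
Qed.

End caratheodory_solution.

(** * Primitives of bounded measurable functions *)

Section scalar_primitive.
Context (R : realType).
Notation mu := (@lebesgue_measure R).

Lemma lebesgue_measure_itv_lty (c d : R) : (mu `[c, d]%classic < +oo)%E.
Proof.
by rewrite lebesgue_measure_itv/= lte_fin; case: ifP => // _; rewrite -EFinD ltry.
Qed.

Lemma norm_Rintegral_itv_le (c d M : R) (k : R -> R) : c <= d ->
  mu.-integrable `[c, d] (EFin \o k) ->
  (forall s, s \in `[c, d] -> `|k s| <= M) ->
  `|\int[mu]_(s in `[c, d]) k s| <= M * (d - c).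
Proof.
move=> cd ik kM.
have fmu := lebesgue_measure_itv_lty c d.
apply: le_trans (le_normr_Rintegral _ ik) _ => //.
apply: (@le_trans _ _ (\int[mu]_(s in `[c, d]) M)).
  apply: le_Rintegral => //.
  - exact: integrable_abse ik.
  - apply/measurable_bounded_integrable => //; exact: bounded_cst.
rewrite Rintegral_cst//.
have -> // : fine (mu `[c, d]%classic) = d - c.
rewrite lebesgue_measure_itv/= lte_fin.
case: ltP => [//|dc]/=; have -> : d = c by lra.
by rewrite subrr.
Qed.

Context (a b M : R) (M0 : 0 <= M).

(** The integrand is cut off outside [[a, b]], which makes the primitive
Lipschitz on the whole line; it can then be evaluated at delayed times before
[a] and differentiated from both sides at [b]. *)
Definition primitive (g : R -> R) (s : R) : R :=
  \int[mu]_(r in `[a, s]) (g \_ `[a, b]) r.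

Definition bounded_measurable (g : R -> R) : Prop :=
  measurable_fun `[a, b] g /\ forall s, s \in `[a, b] -> `|g s| <= M.

Lemma bounded_measurable_integrable g : bounded_measurable g ->
  mu.-integrable `[a, b] (EFin \o g).
Proof.
move=> [mg gM]; apply: measurable_bounded_integrable => //.
  exact: lebesgue_measure_itv_lty.
exists M; split; [exact: num_real|move=> N MN s /= sab].
exact: le_trans (gM _ sab) (ltW MN).
Qed.

Lemma bounded_measurable_integrable_restrict g A : measurable A ->
  bounded_measurable g -> mu.-integrable A (EFin \o (g \_ `[a, b])).
Proof.
move=> mA /bounded_measurable_integrable.
by rewrite integrable_mkcond// restrict_EFin; exact: integrableS.
Qed.

Lemma norm_patch_le (g : R -> R) (e : R) : 0 <= e ->
  (forall s, s \in `[a, b] -> `|g s| <= e) -> forall s, `|(g \_ `[a, b]) s| <= e.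
Proof.
move=> e0 ge s; rewrite patchE; case: ifPn => [|_]; last by rewrite normr0.
by rewrite inE => /ge.
Qed.

Lemma primitive_left g s : s <= a -> primitive g s = 0.
Proof.
rewrite /primitive le_eqVlt => /predU1P[->|sa].
  by rewrite set_itv1 Rintegral_set1.
by rewrite set_itv_ge ?Rintegral_set0// bnd_simp -ltNge.
Qed.

Lemma primitive_lipschitz g : bounded_measurable g ->
  forall s s', `|primitive g s - primitive g s'| <= M * `|s - s'|.
Proof.
move=> bg; suff main s s' : s' <= s ->
    `|primitive g s - primitive g s'| <= M * `|s - s'|.
  move=> s s'; have [|/ltW] := leP s' s; first exact: main.
  by rewrite distrC (distrC s); exact: main.
move=> s's; rewrite [`|s - s'|]ger0_norm ?subr_ge0//.
have gM := norm_patch_le M0 bg.2.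
have ig c d := bounded_measurable_integrable_restrict
  (measurable_itv (Interval c d)) bg.
have [s'a|as'] := leP s' a.
  rewrite (primitive_left _ s'a) subr0.
  have [sa|/ltW as_] := leP s a.
    by rewrite primitive_left// normr0 mulr_ge0// subr_ge0.
  apply: le_trans (norm_Rintegral_itv_le as_ (ig _ _) _) _ => //.
  by rewrite ler_wpM2l// lerB.
rewrite /primitive Rintegral_itvB ?bnd_simp ?(ltW as')//.
rewrite Rintegral_itv_obnd_cbnd//.
exact: norm_Rintegral_itv_le.
Qed.

Lemma primitive_dist_le g h (e : R) : 0 <= e ->
  bounded_measurable g -> bounded_measurable h ->
  (forall s, s \in `[a, b] -> `|g s - h s| <= e) ->
  forall s, s \in `[a, b] -> `|primitive g s - primitive h s| <= e * (b - a).
Proof.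
move=> e0 bg bh ghe s; rewrite in_itv/= => /andP[as_ sb].
have ig := bounded_measurable_integrable_restrict (measurable_itv `[a, s]) bg.
have ih := bounded_measurable_integrable_restrict (measurable_itv `[a, s]) bh.
rewrite /primitive -RintegralB//.
apply: (@le_trans _ _ (e * (s - a))); last by rewrite ler_wpM2l// lerB.
apply: norm_Rintegral_itv_le => //; first exact: (integrableB _ ig ih).
move=> r _; rewrite !patchE; case: ifPn => [|_]; last by rewrite subrr normr0.
by rewrite inE => /ghe.
Qed.

Lemma eq_primitive g h s : (forall r, r \in `[a, s] -> g r = h r) ->
  primitive g s = primitive h s.
Proof.
move=> gh; apply: eq_Rintegral => r; rewrite inE => rs.
by rewrite !patchE gh.
Qed.

Lemma primitive_is_derive g : bounded_measurable g ->
  {ae mu, forall s, s \in `]a, b] -> is_derive s 1 (primitive g) (g s)}.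
Proof.
move=> bg.
have aeF := ae_filter_ringOfSetsType mu.
have := @FTC1 _ (g \_ `[a, b]) (BLeft a)
  (fun y => bounded_measurable_integrable_restrict (measurable_itv _) bg)
  (integrable_locally_restrict (measurable_itv _)
     (bounded_measurable_integrable bg)).
apply: filterS => s + sab.
move: (sab); rewrite in_itv/= => /andP[as_ sb].
move=> /(_ as_)[ds dE]; split; first exact: ds.
move: dE; rewrite derive1E => ->; rewrite patchE ifT// inE/= in_itv/=.
by rewrite (ltW as_) sb.
Qed.

End scalar_primitive.

(** * Borel representatives of controls *)

Section ball_measurability.
Context (R : realType) (A : set R) (mA : measurable A).
Notation mu := (@lebesgue_measure R).

Definition rat_ball n (q : 'rV[rat]_n) (m : nat) : set 'rV[R]_n :=
  [set x | `|x - map_mx ratr q| < m.+1%:R^-1].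

Lemma rat_ball_open n (q : 'rV[rat]_n) (m : nat) : open (rat_ball q m).
Proof.
rewrite (_ : rat_ball q m = ball (map_mx ratr q : 'rV[R]_n) m.+1%:R^-1).
  exact: ball_open.
by apply/seteqP; split=> x; rewrite /rat_ball -ball_normE/= distrC.
Qed.

(** Balls with rational data are enough to describe continuous functions of [p],
and there are only countably many of them: a Lebesgue measurable control can be
corrected on a single null set for all of them at once. *)
Definition ball_measurable n (p : R -> 'rV[R]_n) : Prop :=
  forall q m, measurable (A `&` p @^-1` rat_ball q m).

Lemma rat_row_dense n (x : 'rV[R]_n) (e : R) : 0 < e ->
  exists q : 'rV[rat]_n, `|x - map_mx ratr q| < e.
Proof.
move=> e0; have /choice[q qx] : forall j, exists q : rat, `|x 0 j - ratr q| < e.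
  move=> j; have [|q] := @rat_in_itvoo _ (x 0 j - e) (x 0 j + e).
    by rewrite ltrBlDr -addrA ltrDl addr_gt0.
  by rewrite in_itv/= => qx; exists q; rewrite distrC ltr_distl.
exists (\row_j q j); rewrite row_norm_lt//; apply/forallP => j.
by rewrite !mxE.
Qed.

Lemma ball_measurable_row_mx m n (p : R -> 'rV[R]_m) (r : R -> 'rV[R]_n) :
  ball_measurable p -> ball_measurable r ->
  ball_measurable (fun s => row_mx (p s) (r s)).
Proof.
move=> mp mr q k.
rewrite (_ : _ `&` _ = (A `&` p @^-1` rat_ball (lsubmx q) k) `&`
                       (A `&` r @^-1` rat_ball (rsubmx q) k)).
  exact: measurableI.
have qE x y : rat_ball q k (row_mx x y) =
    (rat_ball (lsubmx q) k x /\ rat_ball (rsubmx q) k y).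
  rewrite /rat_ball/= -{1}(hsubmxK q) map_row_mx opp_row_mx add_row_mx.
  by rewrite norm_row_mx gt_max; apply/propext; split => /andP.
apply/seteqP; split=> s /=; rewrite qE; first by case=> As [].
by case=> -[As ps] [_ rs].
Qed.

Lemma continuous_ball_measurable n (p : R -> 'rV[R]_n) :
  continuous p -> ball_measurable p.
Proof.
move=> cp q m; apply: measurableI => //; apply: open_measurable.
apply: open_comp; first by move=> s _; exact: cp.
exact: rat_ball_open.
Qed.

(** Continuity of [F] relative to [D] makes the superlevel set of [F \o p] the
union of the preimages under [p] of those rational balls whose trace on [D] lies
in the superlevel set of [F]. *)
Lemma ball_measurable_comp n (D : set 'rV[R]_n) (F : 'rV[R]_n -> R)
    (p : R -> 'rV[R]_n) :
  ball_measurable p -> (forall s, A s -> D (p s)) ->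
  (forall x e, D x -> 0 < e -> exists2 d, 0 < d &
     forall y, D y -> `|x - y| < d -> `|F x - F y| < e) ->
  measurable_fun A (F \o p).
Proof.
move=> mp pD cF _; apply: (measurability _ (RGenOInfty.measurableE R)) => //.
move=> _ [_ [c ->] <-].
pose G (k : 'rV[rat]_n * nat) := [set s | [/\ A s, rat_ball k.1 k.2 (p s) &
  forall y, D y -> rat_ball k.1 k.2 y -> c < F y]].
rewrite (_ : _ `&` _ = \bigcup_k G k).
  apply: countable_bigcupT_measurable; first exact: countableP.
  move=> [q m]; rewrite /G/=.
  have [h|nh] := pselect (forall y, D y -> rat_ball q m y -> c < F y).
    rewrite (_ : [set _ | _] = A `&` p @^-1` rat_ball q m); first exact: mp.
    by apply/seteqP; split=> s /=; [case|move=> []].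
  rewrite (_ : [set _ | _] = set0) ?measurable0//.
  by apply/seteqP; split=> s //= [].
apply/seteqP; split=> [s /= [As]|s [[q m] _] /= [As qs h]]; last first.
  by split => //; rewrite in_itv/= andbT; exact: h (pD _ As) qs.
rewrite in_itv/= andbT -subr_gt0 => cFs.
have [d d0 Fd] := cF _ _ (pD _ As) cFs.
have [m md] : exists m : nat, m.+1%:R^-1 < d / 2.
  have d20 : 0 < (d / 2)^-1 by rewrite invr_gt0 divr_gt0.
  exists (Num.truncn (d / 2)^-1); rewrite invf_plt ?posrE ?divr_gt0//.
  exact: truncnS_gt.
have m0 : 0 < m.+1%:R^-1 :> R by rewrite invr_gt0.
have [q qs] := rat_row_dense (p s) m0.
exists (q, m) => //; split => // y Dy; rewrite /rat_ball/= => qy.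
have := Fd _ Dy; rewrite ltr_distl => Fy.
suff /Fy/andP[_] : `|p s - y| < d by rewrite /=; lra.
have -> : p s - y = (p s - map_mx ratr q) - (y - map_mx ratr q).
  by rewrite opprB addrA subrK.
apply: le_lt_trans (ler_normB _ _) _.
by rewrite [d]splitr; apply: ltrD; [exact: lt_trans qs md|exact: lt_trans qy md].
Qed.

End ball_measurability.

Section borel_representative.
Context (R : realType).
Notation mu := (@lebesgue_measure R).

Lemma lebesgue_measurable_null (A : set R) : lebesgue_measurable A ->
  exists N, [/\ measurable N, mu N = 0%E & measurable (A `\` N)].
Proof.
rewrite /lebesgue_measurable g_sigma_completed_algebra_genE.
move=> [B mB [N0 [N [mN N0mu N0N]]] <-]; exists N; split => //.
rewrite setDUl (_ : N0 `\` N = set0) ?setU0; first exact: measurableD.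
by apply/seteqP; split => // x [] /N0N.
Qed.

Lemma countable_lebesgue_measurable_null (I : countType) (A : I -> set R) :
  (forall i, lebesgue_measurable (A i)) ->
  exists N, [/\ measurable N, mu N = 0%E & forall i, measurable (A i `\` N)].
Proof.
move=> mA; have /choice[N Nh] := fun i => lebesgue_measurable_null (mA i).
pose N' (k : nat) := if unpickle k is Some i then N i else set0.
have mN' k : measurable (N' k).
  by rewrite /N'; case: unpickle => [i|//]; case: (Nh i).
have mbN : measurable (\bigcup_k N' k) by exact: bigcupT_measurable.
exists (\bigcup_k N' k); split => //.
  apply/negligibleP => //; apply: negligible_bigcup => k.
  by apply/negligibleP => //; rewrite /N'; case: unpickle => [i|//]; case: (Nh i).
move=> i; rewrite (_ : _ `\` _ = (A i `\` N i) `\` \bigcup_k N' k).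
  by apply: measurableD => //; case: (Nh i).
apply/seteqP; split=> x /= [Ax nx]; split => //; last by case: Ax.
by split => // Nx; apply: nx; exists (pickle i) => //; rewrite /N' pickleK.
Qed.

(** On the null set where the traces of [u] on rational balls fail to be Borel, the
control is reset to the constant [u t], which keeps its values in [U]. *)
Lemma admissible_control_borel nu (U : set 'rV[R]_nu) (t : R)
    (u : R -> 'rV[R]_nu) : t < 0 -> admissible_control U t u ->
  exists v, [/\ forall s, s \in `[t, 0] -> U (v s),
    ball_measurable `[t, 0] v &
    {ae mu, forall s, s \in `[t, 0] -> v s = u s}].
Proof.
move=> t0 [uU mu_].
have ob (k : 'rV[rat]_nu * nat) : open (@rat_ball R _ k.1 k.2).
  exact: rat_ball_open.
have [N [mN N0 mAN]] := countable_lebesgue_measurable_null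
  (fun k => mu_ _ (ob k)).
pose v s := if s \in N then u t else u s.
have tt : t \in `[t, 0] by rewrite in_itv/= lexx ltW.
exists v; split.
- by move=> s st; rewrite /v; case: ifP => _; exact: uU.
- move=> q m.
  have mI : measurable (`[t, 0] `&` N : set R) by exact: measurableI.
  have [h|h] := pselect (rat_ball q m (u t)).
  + rewrite (_ : _ `&` _ = (`[t, 0] `&` N) `|`
      ((`[t, 0] `&` u @^-1` rat_ball q m) `\` N)).
      by apply: measurableU => //; exact: (mAN (q, m)).
    apply/seteqP; split=> s /=; rewrite /v.
      by case: ifPn; rewrite ?inE ?notin_setE => Ns [st us]; [left|right].
    case=> [[st Ns]|[[st us] Ns]]; split => //; first by rewrite ifT// inE.
    by rewrite ifF//; apply/negbTE; rewrite notin_setE.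
  + rewrite (_ : _ `&` _ = (`[t, 0] `&` u @^-1` rat_ball q m) `\` N).
      exact: (mAN (q, m)).
    apply/seteqP; split=> s /=; rewrite /v.
      by case: ifPn; rewrite ?inE ?notin_setE => Ns [st us].
    case=> [[st us] Ns]; split => //.
    by rewrite ifF//; apply/negbTE; rewrite notin_setE.
- exists N; split => // s /=; apply: contra_notP => Ns st.
  by rewrite /v ifF//; apply/negbTE; rewrite notin_setE.
Qed.

End borel_representative.

(** * Compactness of Lipschitz curves *)

Definition lipschitz_curve (R : realType) (V : normedModType R) (M : R)
    (y : R -> V) : Prop :=
  forall s s', `|y s - y s'| <= M * `|s - s'|.

Section lipschitz_curves.
Context (R : realType) (n : nat) (M : R).
Implicit Types y : R -> 'rV[R]_n.

Lemma lipschitz_curve_continuous y : lipschitz_curve M y -> continuous y.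
Proof.
move=> yM s; apply/cvgrPdist_lt => e e0.
have M1 : 0 < `|M| + 1 by rewrite ltr_wpDl.
near=> s'.
have ss' : `|s - s'| < e / (`|M| + 1).
  near: s'; apply: (@cvgr_dist_lt _ _ _ (nbhs s) _ id) => //.
  by rewrite divr_gt0.
rewrite ltr_pdivlMr// mulrC in ss'.
apply: le_lt_trans (yM _ _) _; apply: le_lt_trans ss'.
by rewrite ler_wpM2r// (le_trans (ler_norm _))// lerDl.
Unshelve. all: by end_near.
Qed.

(** The curves through a common point form a subset of a product of closed
balls, which is compact for pointwise convergence.  The common Lipschitz constant
turns closeness at finitely many times into closeness on the whole segment. *)
Lemma lipschitz_curves_cluster (a b : R) (y0 : 'rV[R]_n)
    (y_ : nat -> R -> 'rV[R]_n) :
  0 <= M -> (forall k, lipschitz_curve M (y_ k)) -> (forall k, y_ k a = y0) ->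
  exists y, [/\ lipschitz_curve M y, y a = y0 &
    forall e k0, 0 < e -> exists2 k, (k0 <= k)%N &
      forall s, s \in `[a, b] -> `|y_ k s - y s| < e].
Proof.
move=> M0 yM ya.
pose A (s : R) := [set x : 'rV[R]_n | `|x - y0| <= M * `|s - a|].
have cA s : compact (A s).
  rewrite (_ : A s = closed_ball_ (fun x : 'rV[R]_n => `|x|) y0 (M * `|s - a|)).
    apply: bounded_closed_compact; last exact: closed_closed_ball_.
    exists (`|y0| + M * `|s - a|); split; first exact: num_real.
    move=> N /ltW yN x /=; rewrite /closed_ball_/= distrC => xy.
    apply: le_trans yN; rewrite -[x](subrK y0) addrC.
    by apply: le_trans (ler_normD _ _) _; rewrite lerD2l.
  by apply/seteqP; split=> x; rewrite /A /closed_ball_/= distrC.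
pose F : set_system (prod_topology (fun _ : R => 'rV[R]_n)) := y_ @ \oo.
have FF : ProperFilter F by exact: fmap_proper_filter.
have FA : F [set f | forall s, A s (f s)].
  by exists 0%N => // k _ s; rewrite /A/= -(ya k); exact: yM.
have [y [_ cly]] := tychonoff cA FF FA.
have near_y N (p : 'I_N -> R) e k0 : 0 < e -> exists2 k, (k0 <= k)%N &
    forall i, `|y_ k (p i) - y (p i)| < e.
  move=> e0.
  have near_i i : nbhs (y : prod_topology (fun _ : R => 'rV[R]_n))
      [set f | `|f (p i) - y (p i)| < e].
    have /= := @proj_continuous R (fun=> 'rV[R]_n) (p i) y.
    move=> /cvgrPdist_lt/(_ _ e0) H.
    have := @filterS _ (nbhs y) (nbhs_filter y) _ _ _
      (H (nbhs_filter y)); apply => f /=.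
    by rewrite /proj distrC.
  have [_ [[k k0k <-] /= yk]] : [set y_ k | k in [set k | (k0 <= k)%N]] `&`
      [set f : prod_topology (fun _ : R => 'rV[R]_n) |
        forall i, `|f (p i) - y (p i)| < e] !=set0.
    apply: cly.
      by exists k0 => // k /= k0k; exists k.
    exact: (@filter_forall _ _ _ _ (nbhs_filter y) near_i).
  by exists k.
have near1 s e : 0 < e -> exists k, `|y_ k s - y s| < e.
  by move=> /(@near_y 1%N (fun=> s) _ 0%N)[k _ /(_ ord0)]; exists k.
have yL : lipschitz_curve M y.
  move=> s s'; apply/ler_addgt0Pr => e e0.
  have e20 : 0 < e / 2 by rewrite divr_gt0.
  have [k _ yk] := @near_y 2%N (fun i => if i : nat is 0%N then s else s') _ 0%N e20.
  have := yk ord0; have := yk (lift ord0 ord0); rewrite /= => ys' ys.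
  have -> : y s - y s' = (y s - y_ k s) + (y_ k s - y_ k s') + (y_ k s' - y s').
    by rewrite !addrA !subrK.
  apply: le_trans (ler_normD _ _) _; rewrite [e]splitr [leRHS]addrA.
  apply: lerD; last exact: ltW.
  apply: le_trans (ler_normD _ _) _; rewrite [leRHS]addrC.
  by apply: lerD; [rewrite distrC ltW|exact: yM].
exists y; split => //.
  apply/eqP; rewrite -subr_eq0 -normr_le0; apply/ler_addgt0Pr => e e0.
  by have [k] := near1 a _ e0; rewrite ya add0r distrC => /ltW.
move=> e k0 e0.
pose d := e / (4 * (M + 1)).
have M1 : 0 < M + 1 by rewrite ltr_wpDl.
have d0 : 0 < d by rewrite divr_gt0// mulr_gt0.
have Md : M * d <= e / 4.
  have dE : d * (M + 1) = e / 4 by rewrite /d invfM mulrA divfK// gt_eqF.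
  lra.
have e20 : 0 < e / 2 by rewrite divr_gt0.
pose N := (Num.truncn ((b - a) / d)).+1.
have [k k0k yk] := @near_y N (fun i => a + i%:R * d) _ k0 e20.
exists k => // s; rewrite in_itv/= => /andP[as_ sb].
have sad : 0 <= (s - a) / d by rewrite divr_ge0 ?subr_ge0// ltW.
have iN : (Num.truncn ((s - a) / d) < N)%N.
  rewrite ltnS; apply: le_truncn.
  by rewrite ler_wpM2r ?invr_ge0 ?(ltW d0)// lerB.
have := yk (Ordinal iN); rewrite /=.
set s' := a + _ => yk'.
have ss' : `|s - s'| <= d.
  have := truncn_itv sad; rewrite ler_pdivlMr// ltr_pdivrMr// => /andP[l u].
  rewrite /s' opprD addrA ger0_norm ?subr_ge0// lerBlDr.
  by rewrite (le_trans (ltW u))// -natr1 mulrDl mul1r addrC.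
have Ms : M * `|s - s'| <= e / 4 by rewrite (le_trans _ Md)// ler_wpM2l.
have -> : y_ k s - y s = (y_ k s - y_ k s') + (y_ k s' - y s') + (y s' - y s).
  by rewrite !addrA !subrK.
apply: le_lt_trans (ler_normD _ _) _.
apply: le_lt_trans (lerD (ler_normD _ _) (lexx _)) _.
have := yM k s s'; have := yL s' s; rewrite [`|s' - s|]distrC; lra.
Qed.

End lipschitz_curves.

(** * Caratheodory's existence theorem *)

Section caratheodory_existence.
Context (R : realType) (n : nat) (a b M : R).
Context (g : R -> 'rV[R]_n -> 'rV[R]_n) (y0 : 'rV[R]_n).
Notation mu := (@lebesgue_measure R).
Context (M0 : 0 <= M).
Context (g_bounded : forall s y, s \in `[a, b] -> `|g s y| <= M).
Context (g_equicontinuous : forall e, 0 < e -> exists2 d, 0 < d &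
  forall s y y', s \in `[a, b] -> `|y - y'| < d -> `|g s y - g s y'| < e).
Context (g_measurable : forall c, continuous c ->
  forall j, measurable_fun `[a, b] (fun s => g s (c s) 0 j)).

Definition picard (c : R -> 'rV[R]_n) (s : R) : 'rV[R]_n :=
  y0 + \row_j primitive a b (fun r => g r (c r) 0 j) s.

Lemma velocity_bounded_measurable c j : continuous c ->
  bounded_measurable a b M (fun r => g r (c r) 0 j).
Proof.
move=> cc; split; first exact: g_measurable.
by move=> s sab; apply: le_trans (row_coord_le _ _) (g_bounded _ sab).
Qed.

Lemma picard_lipschitz c : continuous c -> lipschitz_curve M (picard c).
Proof.
move=> cc s s'; rewrite /picard opprD addrACA subrr add0r.
rewrite row_norm_le ?mulr_ge0//; apply/forallP => j; rewrite !mxE.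
exact: primitive_lipschitz (velocity_bounded_measurable _ cc) _ _.
Qed.

Lemma picard_left c s : s <= a -> picard c s = y0.
Proof.
move=> sa; rewrite /picard -[RHS]addr0; congr (_ + _).
by apply/rowP => j; rewrite !mxE primitive_left.
Qed.

Lemma eq_picard c c' s : (forall r, r \in `[a, s] -> c r = c' r) ->
  picard c s = picard c' s.
Proof.
move=> cc'; rewrite /picard; congr (_ + _); apply/rowP => j; rewrite !mxE.
by apply: eq_primitive => r rs; rewrite cc'.
Qed.

Lemma picard_dist_le c c' (e : R) : a <= b -> 0 <= e ->
  continuous c -> continuous c' ->
  (forall s, s \in `[a, b] -> `|g s (c s) - g s (c' s)| <= e) ->
  forall s, s \in `[a, b] -> `|picard c s - picard c' s| <= e * (b - a).
Proof.
move=> ab e0 cc cc' gcc' s sab; rewrite /picard opprD addrACA subrr add0r.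
rewrite row_norm_le ?mulr_ge0 ?subr_ge0//; apply/forallP => j; rewrite !mxE.
apply: (primitive_dist_le e0 (velocity_bounded_measurable _ cc)
  (velocity_bounded_measurable _ cc')) => // r rab.
have := row_coord_le (g r (c r) - g r (c' r)) j; rewrite !mxE => h.
exact: le_trans h (gcc' _ rab).
Qed.

(** Tonelli's approximations, with the delayed equation solved by iteration. *)
Fixpoint delayed_picard (h : R) (k : nat) : R -> 'rV[R]_n :=
  if k is k'.+1 then picard (fun s => delayed_picard h k' (s - h))
  else fun=> y0.

Lemma shift_continuous (h : R) (c : R -> 'rV[R]_n) :
  lipschitz_curve M c -> continuous (fun s => c (s - h)).
Proof.
move=> cM; apply: (@lipschitz_curve_continuous _ _ M) => s s'.
by apply: le_trans (cM _ _) _; rewrite opprB addrA subrK.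
Qed.

Lemma delayed_picard_lipschitz h k : lipschitz_curve M (delayed_picard h k).
Proof.
elim: k => [|k ih] /=; first by move=> s s'; rewrite subrr normr0 mulr_ge0.
by apply: picard_lipschitz; exact: shift_continuous.
Qed.

(** The value at time [s] of an iterate only uses the previous iterate up to time
[s - h], so each iteration settles one more segment of length [h]. *)
Lemma delayed_picard_stable h k s : 0 <= h -> s <= a + k%:R * h ->
  delayed_picard h k.+1 s = delayed_picard h k s.
Proof.
move=> h0; elim: k s => [|k ih] s sk.
  by rewrite [LHS]picard_left// -[leRHS]addr0 -(mul0r h).
apply: eq_picard => r; rewrite in_itv/= => /andP[_ rs]; apply: ih.
by rewrite lerBlDr (le_trans rs)// (le_trans sk)// -natr1 mulrDl mul1r addrA.
Qed.

Lemma delayed_solution h : a <= b -> 0 < h -> exists y,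
  [/\ lipschitz_curve M y, y a = y0 &
   forall s, s \in `[a, b] -> y s = picard (fun r => y (r - h)) s].
Proof.
move=> ab h0; pose k := (Num.truncn ((b - a) / h)).+1.
exists (delayed_picard h k); split; first exact: delayed_picard_lipschitz.
  by rewrite /= picard_left.
move=> s; rewrite in_itv/= => /andP[_ sb].
apply/esym/(@delayed_picard_stable h k); first exact: ltW.
rewrite (le_trans sb)// -lerBlDl -ler_pdivrMr//.
by rewrite ltW// /k truncnS_gt.
Qed.

(** A delayed solution that is uniformly close to the cluster point is, after the
shift by the small delay, still close to it, at a distance governed by the
common Lipschitz constant. The modulus of continuity of [g] in the state does not
depend on time, so the velocities and their primitives are uniformly close
too. *)
Lemma caratheodory_integral_equation : a <= b -> exists y,
  lipschitz_curve M y /\ forall s, s \in `[a, b] -> y s = picard y s.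
Proof.
move=> ab.
have /choice[y_ hy] : forall k : nat, exists y,
    [/\ lipschitz_curve M y, y a = y0 & forall s, s \in `[a, b] ->
       y s = picard (fun r => y (r - k.+1%:R^-1)) s].
  by move=> k; apply: delayed_solution => //; rewrite invr_gt0.
have yM k : lipschitz_curve M (y_ k) by case: (hy k).
have ya k : y_ k a = y0 by case: (hy k).
have yE k s : s \in `[a, b] -> y_ k s = picard (fun r => y_ k (r - k.+1%:R^-1)) s.
  by case: (hy k) => _ _; exact.
have [y [yL _ ycl]] := lipschitz_curves_cluster b M0 yM ya.
exists y; split => // s sab.
apply/eqP; rewrite -subr_eq0 -normr_le0; apply/ler_addgt0Pr => e e0.
rewrite add0r.
have ba1 : 0 < b - a + 1 by rewrite ltr_wpDl ?subr_ge0.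
have [d d0 gd] : exists2 d, 0 < d & forall s y y', s \in `[a, b] ->
    `|y - y'| < d -> `|g s y - g s y'| < e / 2 / (b - a + 1).
  by apply: g_equicontinuous; rewrite !divr_gt0.
have [k0 k0d] : exists k0 : nat, M / k0.+1%:R < d / 2.
  exists (Num.truncn (M / (d / 2))); rewrite ltr_pdivrMr// mulrC.
  by rewrite -ltr_pdivrMr ?divr_gt0// truncnS_gt.
have m0 : 0 < Num.min (d / 2) (e / 2) by rewrite lt_min !divr_gt0.
have [k k0k yk] := ycl _ k0 m0.
have kd : M / k.+1%:R < d / 2.
  apply: le_lt_trans k0d; rewrite ler_wpM2l// lef_pV2 ?posrE//.
  by rewrite ler_nat ltnS.
have -> : y s - picard y s = (y s - y_ k s) + (y_ k s - picard y s).
  by rewrite addrA subrK.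
apply: le_trans (ler_normD _ _) _; rewrite [e]splitr; apply: lerD.
  have := yk _ sab; rewrite lt_min distrC => /andP[_]; exact: ltW.
rewrite yE//.
apply: (@le_trans _ _ (e / 2 / (b - a + 1) * (b - a))); last first.
  by rewrite -mulrA ler_piMr ?divr_ge0 ?(ltW e0)// ler_pdivrMl// mulr1 lerDl.
apply: picard_dist_le => //.
- by rewrite !divr_ge0 ?(ltW e0)// ltW.
- exact: shift_continuous.
- exact: lipschitz_curve_continuous yL.
move=> r rab; apply/ltW/gd => //.
rewrite -(subrK (y_ k r) (y_ k (r - _))) -addrA [d]splitr.
apply: le_lt_trans (ler_normD _ _) _; apply: ltrD.
  apply: le_lt_trans (yM _ _ _) _.
  by rewrite addrAC subrr add0r normrN ger0_norm.
by have := yk _ rab; rewrite lt_min => /andP[].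
Qed.

Lemma caratheodory_existence : a <= b -> exists y,
  y a = y0 /\ ac_primitive a b (fun s => g s (y s)) y.
Proof.
have aeF := ae_filter_ringOfSetsType mu.
move=> /[dup] ab /caratheodory_integral_equation[y [yL yE]].
have cy := lipschitz_curve_continuous yL.
(* The equation y = picard y holds on [a, b] only, and a derivative at b also
   depends on the values beyond b, which are under control for picard y. *)
exists (picard y); split; first by rewrite picard_left.
split; first exact: lipschitz_absolutely_continuous (picard_lipschitz cy).
have dj : {ae mu, forall s, forall j : 'I_n, s \in `]a, b] ->
    is_derive s 1 (primitive a b (fun r => g r (y r) 0 j)) (g s (y s) 0 j)}.
  apply: (@filter_forall _ _ _ _ aeF) => j.
  exact: primitive_is_derive (velocity_bounded_measurable _ cy).
(* The primitive may have a corner at a, as it is constant before a. *)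
have na : {ae mu, forall s, s != a}.
  exists [set a]; split => //; first exact: lebesgue_measure_set1.
  by move=> s /= /negP; rewrite negbK => /eqP.
apply: filterS2 dj na => s ds sa sab; rewrite -yE//.
apply/is_derive_rowP => j; under eq_fun do rewrite /picard !mxE.
rewrite -[X in is_derive _ _ _ X]add0r; apply: is_deriveD; apply: ds.
by move: sab; rewrite !in_itv/= lt_neqAle eq_sym sa.
Qed.

End caratheodory_existence.

(** * Trajectories of decomposed systems *)

(** Along a given curve [yc] and a given control, the equation of the remaining
block is a differential equation with measurable time dependence, to which
Caratheodory's theorem applies once the control is replaced by a Borel one. *)
Lemma admissible_block_solution (R : realType) (n nc nu : nat)
    (U : set 'rV[R]_nu) (F : 'rV[R]_n -> 'rV[R]_nc -> 'rV[R]_nu -> 'rV[R]_n)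
    (M t : R) (u : R -> 'rV[R]_nu) (yc : R -> 'rV[R]_nc) (y0 : 'rV[R]_n) :
  (forall y c w, U w -> `|F y c w| <= M) ->
  (forall e, 0 < e -> exists2 d, 0 < d & forall y y' c c' w w', U w -> U w' ->
     `|y - y'| < d -> `|c - c'| < d -> `|w - w'| < d ->
     `|F y c w - F y' c' w'| < e) ->
  t < 0 -> admissible_control U t u -> absolutely_continuous t 0 yc ->
  exists y, y t = y0 /\ ac_primitive t 0 (fun s => F (y s) (yc s) (u s)) y.
Proof.
move=> FM Fc t0 adm acy.
have [v [vU vmeas vu]] := admissible_control_borel t0 adm.
have aeF := ae_filter_ringOfSetsType (@lebesgue_measure R).
(* Nothing is known about yc outside [t, 0]; freezing it at the end points makes
   it continuous on the whole line. *)
pose clamp s := Num.max t (Num.min 0 s).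
have clampI s : clamp s \in `[t, 0].
  by rewrite in_itv/= le_max lexx/= ge_max (ltW t0) ge_min lexx.
have clampE s : s \in `[t, 0] -> clamp s = s.
  by rewrite in_itv/= => /andP[ts s0]; rewrite /clamp (min_idPr s0) (max_idPr ts).
have clampL s s' : `|clamp s - clamp s'| <= `|s - s'|.
  have le_dist : s - s' <= `|s - s'| /\ s' - s <= `|s - s'|.
    by rewrite ler_norm distrC ler_norm.
  have := normr_ge0 (s - s'); rewrite /clamp ler_norml.
  case: (leP 0 s) => ?; case: (leP 0 s') => ?;
    [case: (leP t 0)|case: (leP t s'); case: (leP t 0)|
     case: (leP t s); case: (leP t 0)|case: (leP t s); case: (leP t s')] => *; lra.
have cyc : continuous (yc \o clamp).
  move=> s; apply/cvgrPdist_lt => e e0.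
  have [d d0 yd] := absolutely_continuous_dist acy e0.
  near=> s'; apply: yd => //; apply: le_lt_trans (clampL _ _) _.
  by near: s'; exact: (@cvgr_dist_lt _ _ _ (nbhs s) _ id).
pose g s y := F y (yc (clamp s)) (v s).
have M0 : 0 <= M.
  apply: le_trans (normr_ge0 (F y0 0 (u t))) (FM _ _ _ _).
  by apply: adm.1; rewrite in_itv/= lexx ltW.
have [//|//|//|y [yt yP]] :=
  @caratheodory_existence R n t 0 M g y0 M0 _ _ _ (ltW t0).
- by move=> s y st; apply: FM; exact: vU.
- move=> e /Fc[d d0 Fd]; exists d => // s y y' st yy'.
  by apply: Fd; rewrite ?subrr ?normr0//; exact: vU.
- move=> c cc j.
  pose D : set 'rV[R]_(n + nc + nu) := [set x | U (rsubmx x)].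
  pose G (x : 'rV[R]_(n + nc + nu)) :=
    F (lsubmx (lsubmx x)) (rsubmx (lsubmx x)) (rsubmx x) 0 j.
  pose p s := row_mx (row_mx (c s) (yc (clamp s))) (v s).
  rewrite (_ : (fun s => _) = G \o p); last first.
    by apply/funext => s; rewrite /G/p/= !row_mxKl !row_mxKr.
  apply: (@ball_measurable_comp _ _ _ _ D).
  + exact: measurable_itv.
  + apply: ball_measurable_row_mx => //.
    by apply: ball_measurable_row_mx; apply: continuous_ball_measurable.
  + by move=> s st; rewrite /D/p/= row_mxKr; exact: vU.
  move=> x e Dx /Fc[d d0 Fd]; exists d => // x' Dx'.
  rewrite -{1}(hsubmxK x) -{1}(hsubmxK (lsubmx x)).
  rewrite -{1}(hsubmxK x') -{1}(hsubmxK (lsubmx x')).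
  rewrite !opp_row_mx !add_row_mx !norm_row_mx !gt_max => /andP[/andP[l1 l2] l3].
  apply: le_lt_trans (Fd _ _ _ _ _ _ Dx Dx' l1 l2 l3).
  by rewrite /G; apply: le_trans (row_coord_le _ j); rewrite !mxE.
exists y; split => //; apply: eq_ac_primitive yP.
by apply: filterS vu => s vus st; rewrite /g vus// clampE.
Unshelve. all: by end_near.
Qed.

Section decomposition.
Context (R : realType) (n1 n2 nc nu : nat).
Context (U : set 'rV[R]_nu) (t : R) (u : R -> 'rV[R]_nu).
Context (f1 : 'rV[R]_n1 -> 'rV[R]_nc -> 'rV[R]_nu -> 'rV[R]_n1)
        (f2 : 'rV[R]_n2 -> 'rV[R]_nc -> 'rV[R]_nu -> 'rV[R]_n2)
        (fc : 'rV[R]_nc -> 'rV[R]_nu -> 'rV[R]_nc).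

Lemma trajectoryE n (f : 'rV[R]_n -> 'rV[R]_nu -> 'rV[R]_n) z zeta :
  trajectory f z t u zeta <->
  zeta t = z /\ ac_primitive t 0 (fun s => f (zeta s) (u s)) zeta.
Proof. by split=> [[]|[? []]]. Qed.

Lemma trajectory_subsystem z zc (y : R -> 'rV[R]_n1) (yc : R -> 'rV[R]_nc) :
  trajectory (subsystem f1 fc) (row_mx z zc) t u (fun s => row_mx (y s) (yc s)) <->
  [/\ y t = z, yc t = zc,
      ac_primitive t 0 (fun s => f1 (y s) (yc s) (u s)) y &
      ac_primitive t 0 (fun s => fc (yc s) (u s)) yc].
Proof.
rewrite trajectoryE.
under [X in ac_primitive _ _ X _]eq_fun do
  rewrite /subsystem row_mxKl row_mxKr.
rewrite ac_primitive_row_mx.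
by split=> [[/eq_row_mx[-> ->] []]|[-> -> ]].
Qed.

Lemma trajectory_decomposed (f : 'rV[R]_(n1 + n2 + nc) -> 'rV[R]_nu -> _)
    z1 z2 zc (y1 : R -> 'rV[R]_n1) (y2 : R -> 'rV[R]_n2) (yc : R -> 'rV[R]_nc) :
  (forall z1 z2 zc u, U u -> f (row_mx (row_mx z1 z2) zc) u =
       row_mx (row_mx (f1 z1 zc u) (f2 z2 zc u)) (fc zc u)) ->
  (forall s, s \in `[t, 0] -> U (u s)) ->
  trajectory f (row_mx (row_mx z1 z2) zc) t u
    (fun s => row_mx (row_mx (y1 s) (y2 s)) (yc s)) <->
  [/\ y1 t = z1, y2 t = z2 & yc t = zc] /\
  [/\ ac_primitive t 0 (fun s => f1 (y1 s) (yc s) (u s)) y1,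
      ac_primitive t 0 (fun s => f2 (y2 s) (yc s) (u s)) y2 &
      ac_primitive t 0 (fun s => fc (yc s) (u s)) yc].
Proof.
move=> fE uU; rewrite trajectoryE.
set v := fun s => f _ _.
set w := fun s => row_mx (row_mx (f1 (y1 s) (yc s) (u s)) (f2 (y2 s) (yc s) (u s)))
  (fc (yc s) (u s)).
have vw s : s \in `[t, 0] -> v s = w s by move=> st; rewrite /v fE//; exact: uU.
have vwE y : ac_primitive t 0 v y <-> ac_primitive t 0 w y.
  by split; apply: eq_ac_primitive; apply: aeW => s st; rewrite vw.
rewrite vwE !ac_primitive_row_mx; split.
  by move=> [/eq_row_mx[/eq_row_mx[-> ->] ->] [[]]].
by move=> [[-> -> ->] []].
Qed.

End decomposition.

Section block_regularity.
Context (R : realType) (n1 n2 nc nu : nat) (U : set 'rV[R]_nu).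
Context (f : 'rV[R]_(n1 + n2 + nc) -> 'rV[R]_nu -> 'rV[R]_(n1 + n2 + nc)).
Context (f1 : 'rV[R]_n1 -> 'rV[R]_nc -> 'rV[R]_nu -> 'rV[R]_n1)
        (f2 : 'rV[R]_n2 -> 'rV[R]_nc -> 'rV[R]_nu -> 'rV[R]_n2)
        (fc : 'rV[R]_nc -> 'rV[R]_nu -> 'rV[R]_nc).
Context (f_unif : unif_continuous_on (setT `*` U) (fun p => f p.1 p.2)).
Context (f_bounded : [bounded f p.1 p.2 | p in setT `*` U]).
Context (f_decomposes : forall z1 z2 zc u, U u ->
  f (row_mx (row_mx z1 z2) zc) u =
  row_mx (row_mx (f1 z1 zc u) (f2 z2 zc u)) (fc zc u)).

Lemma blocks_bounded : exists M,
  (forall z zc u, U u -> `|f1 z zc u| <= M) /\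
  (forall z zc u, U u -> `|f2 z zc u| <= M).
Proof.
have [N [_ NM]] := f_bounded; exists (N + 1).
have fN z u : U u -> `|f z u| <= N + 1.
  by move=> Uu; apply: (NM _ _ (z, u)) => //; rewrite ltrDl.
split=> z zc u Uu.
- have := fN (row_mx (row_mx z 0) zc) u Uu.
  by rewrite f_decomposes// !norm_row_mx !ge_max => /andP[/andP[]].
- have := fN (row_mx (row_mx 0 z) zc) u Uu.
  by rewrite f_decomposes// !norm_row_mx !ge_max => /andP[/andP[]].
Qed.

Lemma blocks_unif_continuous e : 0 < e -> exists2 d, 0 < d &
  forall z1 z1' z2 z2' zc zc' u u', U u -> U u' ->
    `|z1 - z1'| < d -> `|z2 - z2'| < d -> `|zc - zc'| < d -> `|u - u'| < d ->
    `|f1 z1 zc u - f1 z1' zc' u'| < e /\ `|f2 z2 zc u - f2 z2' zc' u'| < e.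
Proof.
move=> /f_unif[d d0 fd]; exists d => // z1 z1' z2 z2' zc zc' u u' Uu Uu' l1 l2 lc lu.
have pq : `|(row_mx (row_mx z1 z2) zc, u) - (row_mx (row_mx z1' z2') zc', u')| < d.
  rewrite prod_normE gt_max /= !opp_row_mx !add_row_mx !norm_row_mx !gt_max.
  by rewrite l1 l2 lc.
have := fd (_, _) (_, _) (conj I Uu) (conj I Uu') pq.
rewrite /= !f_decomposes// !opp_row_mx !add_row_mx !norm_row_mx !gt_max.
by move=> /andP[/andP[]].
Qed.

End block_regularity.

Theorem theorem1 (R : realType) (n1 n2 nc nu : nat)
    (n1_gt0 : (0 < n1)%N) (n2_gt0 : (0 < n2)%N)
    (U : set 'rV[R]_nu) (U_compact : compact U)
    (f : 'rV[R]_(n1 + n2 + nc) -> 'rV[R]_nu -> 'rV[R]_(n1 + n2 + nc))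
    (f_unif_continuous :
       unif_continuous_on (setT `*` U) (fun p => f p.1 p.2))
    (f_bounded : [bounded f p.1 p.2 | p in setT `*` U])
    (f_lipschitz : forall u, U u -> lipschitz (fun z => f z u))
    (f1 : 'rV[R]_n1 -> 'rV[R]_nc -> 'rV[R]_nu -> 'rV[R]_n1)
    (f2 : 'rV[R]_n2 -> 'rV[R]_nc -> 'rV[R]_nu -> 'rV[R]_n2)
    (fc : 'rV[R]_nc -> 'rV[R]_nu -> 'rV[R]_nc)
    (f_decomposes : forall z1 z2 zc u, U u ->
       f (row_mx (row_mx z1 z2) zc) u =
       row_mx (row_mx (f1 z1 zc u) (f2 z2 zc u)) (fc zc u))
    (t : R) (t_lt0 : t < 0)
    (T : set 'rV[R]_(n1 + n2 + nc))
    (T1 : set 'rV[R]_(n1 + nc)) (T2 : set 'rV[R]_(n2 + nc))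
    (T_eq : T = back_proj1 T1 `|` back_proj2 T2) :
  max_brs U f T t =
  back_proj1 (max_brs U (subsystem f1 fc) T1 t) `|`
  back_proj2 (max_brs U (subsystem f2 fc) T2 t).
Proof.
have [M [f1M f2M]] := blocks_bounded f_bounded f_decomposes.
have unif := blocks_unif_continuous f_unif_continuous f_decomposes.
have full := @trajectory_decomposed _ _ _ _ _ U t _ f1 f2 fc f.
have partE z : z = row_mx (row_mx (part1 z) (part2 z)) (partc z).
  by rewrite !hsubmxK.
have part1E z1 z2 zc : part1 (row_mx (row_mx z1 z2) zc : 'rV[R]_(n1 + n2 + nc)) = z1.
  by rewrite /part1 !row_mxKl.
have part2E z1 z2 zc : part2 (row_mx (row_mx z1 z2) zc : 'rV[R]_(n1 + n2 + nc)) = z2.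
  by rewrite /part2 row_mxKl row_mxKr.
have partcE z1 z2 zc : partc (row_mx (row_mx z1 z2) zc : 'rV[R]_(n1 + n2 + nc)) = zc.
  by rewrite /partc row_mxKr.
apply/seteqP; split=> z.
  move=> [u [adm [zeta [+ Tz]]]].
  rewrite [z]partE.
  rewrite (_ : zeta = fun s => row_mx (row_mx (part1 (zeta s)) (part2 (zeta s)))
      (partc (zeta s))); last by apply/funext => s; rewrite -partE.
  move=> /(full _ _ _ _ _ _ _ f_decomposes adm.1)[[i1 i2 ic] [p1 p2 pc]].
  move: Tz; rewrite T_eq => -[T1z|T2z]; [left|right];
    rewrite /back_proj1 /back_proj2/=.
  - rewrite part1E partcE; exists u; split => //.
    exists (fun s => row_mx (part1 (zeta s)) (partc (zeta s))); split => //.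
    exact/trajectory_subsystem.
  - rewrite part2E partcE; exists u; split => //.
    exists (fun s => row_mx (part2 (zeta s)) (partc (zeta s))); split => //.
    exact/trajectory_subsystem.
case=> -[u [adm [xi [+ Tx]]]];
  (rewrite (_ : xi = fun s => row_mx (lsubmx (xi s)) (rsubmx (xi s))); last
     by apply/funext => s; rewrite hsubmxK);
  move=> /trajectory_subsystem[ii ic pi pc].
- have [|y [yt py]] := admissible_block_solution (part2 z) f2M _ t_lt0 adm pc.1.
    move=> e /unif[d d0 fd]; exists d => // y y' c c' w w' Uw Uw' ly lc lw.
    have l0 : `|0 - 0 : 'rV[R]_n1| < d by rewrite subrr normr0.
    by have [] := fd _ _ _ _ _ _ _ _ Uw Uw' l0 ly lc lw.
  exists u; split => //.
  exists (fun s => row_mx (row_mx (lsubmx (xi s)) (y s)) (rsubmx (xi s))); split.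
    by rewrite [z]partE; apply/(full _ _ _ _ _ _ _ f_decomposes adm.1).
  by rewrite T_eq; left; rewrite /back_proj1/= part1E partcE hsubmxK.
- have [|y [yt py]] := admissible_block_solution (part1 z) f1M _ t_lt0 adm pc.1.
    move=> e /unif[d d0 fd]; exists d => // y y' c c' w w' Uw Uw' ly lc lw.
    have l0 : `|0 - 0 : 'rV[R]_n2| < d by rewrite subrr normr0.
    by have [] := fd _ _ _ _ _ _ _ _ Uw Uw' ly l0 lc lw.
  exists u; split => //.
  exists (fun s => row_mx (row_mx (y s) (lsubmx (xi s))) (rsubmx (xi s))); split.
    by rewrite [z]partE; apply/(full _ _ _ _ _ _ _ f_decomposes adm.1).
  by rewrite T_eq; right; rewrite /back_proj2/= part2E partcE hsubmxK.
Qed.
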